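(* For $n\ge1$ and $k\ge 0$, let $\mathcal{P}_{n,k}$ be the set of $\sigma\in\mathfrak{S}_n$ with $\widetilde{\mathrm{M}}(\sigma)=k$. Then $$\sum_{\sigma\in\mathcal{P}_{n,k}}(2\alpha)^{\mathrm{lmi}(\sigma)-1}(2\beta)^{\mathrm{rmi}(\sigma)-1}=\sum_{\sigma\in\mathcal{P}_{n,k}}(\alpha+\beta)^{\mathrm{lmi}(\sigma)+\mathrm{rmi}(\sigma)-2}.$$
   Context: $\mathfrak{S}_n$ is the set of permutations $\sigma=\sigma_1\cdots\sigma_n$ of $[n]$. $\widetilde{\mathrm{M}}(\sigma)$ is the number of indices $i\in[n]$ with $\sigma_{i-1}<\sigma_i>\sigma_{i+1}$ under the boundary convention $\sigma_0=\sigma_{n+1}=+\infty$. $\mathrm{lmi}(\sigma)$ (resp. $\mathrm{rmi}(\sigma)$) is the number of left-to-right minima (resp. right-to-left minima) of $\sigma$, i.e. entries $\sigma_i$ smaller than all entries to their left (resp. right). $\alpha,\beta$ are indeterminates. *)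

(* Defs.v *)
From HB Require Import structures.
From mathcomp Require Import all_boot all_order all_fingroup all_algebra.
From mathcomp Require Import mpoly.

Set Implicit Arguments.
Unset Strict Implicit.
Unset Printing Implicit Defensive.

Import GRing.Theory.
Local Open Scope ring_scope.

(* A permutation s : 'S_n acts on 'I_n = {0, ..., n-1}; the i-th letter of the
   corresponding word on [n] (positions i = 1, ..., n) is (s (i-1)).+1.
   [entry s i] is that letter; at the boundary positions 0 and n+1 it is n+1,
   which stands for +oo since all letters are at most n. *)
Definition entry (n : nat) (s : 'S_n) (i : nat) : nat :=
  nth n.+1 (n.+1 :: [seq (s j).+1 | j <- enum 'I_n]) i.

(* \widetilde{M}(s); the index i : 'I_n represents the position i.+1 in [n]. *)
Definition peaks (n : nat) (s : 'S_n) : nat :=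
  #|[set i : 'I_n | (entry s i < entry s i.+1)%N
                    && (entry s i.+2 < entry s i.+1)%N]|.

Definition lmi (n : nat) (s : 'S_n) : nat :=
  #|[set i : 'I_n | [forall j : 'I_n, (j < i)%N ==> (s i < s j)%N]]|.

Definition rmi (n : nat) (s : 'S_n) : nat :=
  #|[set i : 'I_n | [forall j : 'I_n, (i < j)%N ==> (s i < s j)%N]]|.

Definition perms_with_peaks (n k : nat) : {set 'S_n} :=
  [set s : 'S_n | peaks s == k].

Definition alpha : {mpoly int[2]} := 'X_(@Ordinal 2 0 isT).
Definition beta : {mpoly int[2]} := 'X_(@Ordinal 2 1 isT).

(* Main.v *)
Require Import Defs.
From mathcomp Require Import all_boot all_order all_fingroup all_algebra.
From mathcomp Require Import mpoly.
From mathcomp Require Import ring.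

Set Implicit Arguments.
Unset Strict Implicit.
Unset Printing Implicit Defensive.

Import GRing.Theory.
Local Open Scope ring_scope.

(* Inserting the letter n+1 into a permutation of [n] with p peaks multiplies
   the weight a^(lmi-1) b^(rmi-1) by a (in front), by b (at the end) or by 1
   (elsewhere); the first two insertions and the 2p ones next to a peak keep
   the number of peaks, the n-1-2p others raise it by one. By induction on n,
   the weighted distribution of peaks therefore depends on a + b only, and
   2 alpha + 2 beta = (alpha + beta) + (alpha + beta). *)

(** * Peaks and minima of words of letters *)

Fixpoint word_peaks (w : seq nat) : nat :=
  if w is x :: t then
    ((if t is [:: y, z & _] then (x < y)%N && (z < y)%N else false)
     + word_peaks t)%N
  else 0%N.

Fixpoint word_rmi (w : seq nat) : nat :=
  if w is x :: t then (all (fun y => x < y) t + word_rmi t)%N else 0%N.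

Definition word_lmi (w : seq nat) : nat := word_rmi (rev w).

(** A letter above all others spoils no other letter's minimality, and is itself a right-to-left
    minimum only when nothing follows it. *)
Lemma word_rmi_insert (N : nat) (u v : seq nat) :
  all (fun y => y < N)%N (u ++ v) ->
  word_rmi (u ++ N :: v) = ((v == [::]) + word_rmi (u ++ v))%N.
Proof.
elim: u => [|x u IHu] /=.
  case: v => [|y v] //= /andP[yN _].
  by rewrite ltnNge (ltnW yN).
case/andP=> xN /IHu ->.
by rewrite !all_cat /= xN /= addnCA.
Qed.

Lemma word_lmi_insert (N : nat) (u v : seq nat) :
  all (fun y => y < N)%N (u ++ v) ->
  word_lmi (u ++ N :: v) = ((u == [::]) + word_lmi (u ++ v))%N.
Proof.
move=> uvN; rewrite /word_lmi !rev_cat rev_cons cat_rcons word_rmi_insert.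
  by rewrite -!size_eq0 size_rev.
by rewrite -rev_cat all_rev.
Qed.

(** Makes the truncated subtraction in the exponents exact. *)
Lemma word_rmi_gt0 (w : seq nat) : w != [::] -> (0 < word_rmi w)%N.
Proof.
elim: w => [|x [|y w] IHw] //= _.
by rewrite (leq_trans (IHw isT)) ?leq_addl.
Qed.

Lemma word_lmi_gt0 (w : seq nat) : w != [::] -> (0 < word_lmi w)%N.
Proof. by move=> w0; rewrite word_rmi_gt0 // -size_eq0 size_rev size_eq0. Qed.

(** * Inserting a new largest letter *)

Fixpoint insertions (N : nat) (w : seq nat) : seq (seq nat) :=
  (N :: w) :: if w is x :: t then map (cons x) (insertions N t) else [::].

(** Insertions with a letter on both sides of [N]: exactly those that leave both counts of minima
    unchanged when [N] exceeds every letter. *)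
Fixpoint inner_insertions (N : nat) (w : seq nat) : seq (seq nat) :=
  if w is x :: t then
    if t is _ :: _ then map (cons x) ((N :: t) :: inner_insertions N t)
    else [::]
  else [::].

Lemma mem_insertions (N : nat) (w w' : seq nat) :
  reflect (exists u v, w = u ++ v /\ w' = u ++ N :: v) (w' \in insertions N w).
Proof.
apply: (iffP idP).
  elim: w w' => [|x t IHt] w' /=.
    by rewrite inE => /eqP ->; exists [::], [::].
  rewrite inE => /predU1P[-> | /mapP[t' /IHt [u [v [-> ->]]] ->]].
    by exists [::], (x :: t).
  by exists (x :: u), v.
case=> u [v [-> ->]]; elim: u => [|x u IHu] /=.
  by case: v => [|y v]; rewrite /= inE eqxx.
by rewrite inE map_f ?orbT.
Qed.

Lemma size_insertions (N : nat) (w : seq nat) :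
  size (insertions N w) = (size w).+1.
Proof. by elim: w => //= x t IHt; rewrite size_map IHt. Qed.

Lemma mem_inner_insertions (N : nat) (w w' : seq nat) :
  w' \in inner_insertions N w ->
  exists u v, [/\ u != [::], v != [::], w = u ++ v & w' = u ++ N :: v].
Proof.
elim: w w' => [|x [|y t] IHt] w' //.
rewrite -[inner_insertions _ _]/(map (cons x) ((N :: y :: t) :: inner_insertions N (y :: t))).
case/mapP=> t'; rewrite inE => /predU1P[-> | /IHt [u [v [u0 v0 -> ->]]]] ->.
  by exists [:: x], (y :: t).
by exists (x :: u), v.
Qed.

Lemma big_insertions (R : nmodType) (N x : nat) (t : seq nat)
    (F : seq nat -> R) :
  \sum_(w <- insertions N (x :: t)) F w =
  F (N :: x :: t) + \sum_(w <- inner_insertions N (x :: t)) F w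
  + F (x :: rcons t N).
Proof.
elim: t x F => [|y t IHt] x F.
  by rewrite !big_cons !big_nil !addr0.
rewrite -[insertions _ _]/((N :: x :: y :: t) :: map (cons x) (insertions N (y :: t))).
rewrite -[inner_insertions _ _]
  /(map (cons x) ((N :: y :: t) :: inner_insertions N (y :: t))).
by rewrite big_cons !big_map IHt big_cons !addrA.
Qed.

(** Beside a peak, [N] replaces that peak; in any other inner gap it adds one. Peaks are never
    adjacent, so p of them occupy 2p distinct gaps out of [(size t).+1]. Leaving [F] arbitrary lets
    the induction shift it by a peak at the second letter. *)
Lemma big_peaks_inner_insertions (R : comPzRingType) (N x y : nat)
    (t : seq nat) (F : nat -> R) :
  all (fun z => z < N)%N (x :: y :: t) ->
  \sum_(w <- inner_insertions N (x :: y :: t)) F (word_peaks w) =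
  (word_peaks (x :: y :: t)).*2%:R * F (word_peaks (x :: y :: t))
  + ((size t).+1%:R - (word_peaks (x :: y :: t)).*2%:R)
    * F (word_peaks (x :: y :: t)).+1.
Proof.
elim: t x y F => [|z t IHt] x y F.
  case/and3P=> xN yN _.
  by rewrite big_seq1 /= xN yN /= subr0 mul0r add0r mul1r.
move=> xyztN; have [xN yN zN _] := and4P xyztN.
have yztN : all (fun z => z < N)%N [:: y, z & t] by case/andP: xyztN.
rewrite -[inner_insertions _ _]/([:: x, N, y, z & t] :: [:: x, y, N, z & t]
  :: map (cons x) (map (cons y) (inner_insertions N (z :: t)))).
set p := word_peaks [:: y, z & t].
have peaks_xyzt : word_peaks [:: x, y, z & t] = (((x < y)%N && (z < y)%N) + p)%N.
  by [].
have peaks_xN : word_peaks [:: x, N, y, z & t] = p.+1.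
  by rewrite /p /= xN yN [(N < y)%N]ltnNge (ltnW yN).
have peaks_yN : word_peaks [:: x, y, N, z & t] = word_peaks [:: y, N, z & t].
  by rewrite /= [(N < y)%N]ltnNge (ltnW yN) andbF.
(* These insertions happen after [z], so the triple [x], [y], [z] stays intact. *)
have rest (G : nat -> R) :
    \sum_(w <- map (cons x) (map (cons y) (inner_insertions N (z :: t))))
      G (word_peaks w) =
    \sum_(w <- map (cons y) (inner_insertions N (z :: t)))
      G (((x < y)%N && (z < y)%N) + word_peaks w)%N.
  rewrite big_map big_seq [RHS]big_seq; apply: eq_bigr => w.
  case/mapP=> w' /mem_inner_insertions [[|z' u] [v [//= _ _ [-> _] ->]]] ->.
  by [].
have := IHt y z (fun q => F (((x < y)%N && (z < y)%N) + q)%N) yztN.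
rewrite -[inner_insertions _ _]/([:: y, N, z & t]
  :: map (cons y) (inner_insertions N (z :: t))).
rewrite big_cons -/p => IH.
rewrite !big_cons rest peaks_xN peaks_yN peaks_xyzt.
case: (boolP ((x < y)%N && (z < y)%N)) IH => [/andP[xy zy] | _] IH.
  (* With [y] a peak, [z] is not one, so putting [N] between them destroys no peak of the tail. *)
  have yNE : word_peaks [:: y, N, z & t] = p.+1.
    rewrite /p /= yN zN [(N < z)%N]ltnNge (ltnW zN) [(y < z)%N]ltnNge (ltnW zy).
    by case: (t).
  (* The shifted [F] counts both [y] and [N] for the gap after [y], though [N] has replaced [y].
     That term is moved across, leaving the sum over the later gaps. *)
  move: IH; rewrite yNE !add1n => /(canRL (addKr _)) ->.
  rewrite doubleS -!natr1.
  ring.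
by rewrite !add0n in IH *; rewrite IH -!natr1; ring.
Qed.

(** * Words of permutations and the recurrence for their weighted sum *)

Fixpoint words (n : nat) : seq (seq nat) :=
  if n is m.+1 then [seq w | u <- words m, w <- insertions m.+1 u]
  else [:: [::]].

Lemma mem_words (n : nat) (w : seq nat) :
  (w \in words n) = perm_eq w (iota 1 n).
Proof.
elim: n w => [|n IHn] w.
  by rewrite inE; apply/eqP/perm_nilP.
have iotaS u v : perm_eq (u ++ n.+1 :: v) (iota 1 n.+1)
    = perm_eq (u ++ v) (iota 1 n).
  rewrite -addn1 iotaD /= add1n addn1.
  rewrite (perm_catCA u [:: n.+1] v) perm_sym (perm_catC (iota 1 n)) /=.
  by rewrite perm_cons perm_sym.
apply/idP/idP.
  case/allpairsPdep=> u [w' [uW /mem_insertions [u1 [v1 [uE ->]]] ->]].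
  by rewrite iotaS -uE -IHn.
move=> wP; have Nw : n.+1 \in w by rewrite (perm_mem wP) mem_iota /= add1n.
case/splitPr: Nw wP => u v; rewrite iotaS -IHn => uvW.
apply/allpairsPdep; exists (u ++ v), (u ++ n.+1 :: v); split=> //.
by apply/mem_insertions; exists u, v.
Qed.

(** Used to obtain by counting that [words n] has no duplicates. *)
Lemma size_words (n : nat) : size (words n) = n`!.
Proof.
elim: n => [|n IHn] //.
rewrite /words -/words size_allpairs_dep factS -IHn mulnC -sum1_size.
rewrite sumnE big_map big_distrl /= !big_seq.
apply: eq_bigr => w; rewrite mem_words => /perm_size.
by rewrite size_insertions size_iota mul1n => ->.
Qed.

Definition word_sum (R : pzSemiRingType) (a b : R) (n : nat) (F : nat -> R) :=
  \sum_(w <- words n)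
    F (word_peaks w) * (a ^+ (word_lmi w - 1) * b ^+ (word_rmi w - 1)).

(** A word of length n+1 has two outer gaps, contributing a and b, and n inner ones. The change in
    the peak count is absorbed into [F], so the new test function involves a and b only through
    their sum. *)
Lemma word_sumS (R : comPzRingType) (a b : R) (n : nat) (F : nat -> R) :
  word_sum a b n.+2 F =
  word_sum a b n.+1 (fun p =>
    (a + b + p.*2%:R) * F p + (n%:R - p.*2%:R) * F p.+1).
Proof.
rewrite /word_sum [in LHS]/words -/(words n.+1) big_allpairs_dep.
rewrite !big_seq; apply: eq_bigr => -[|x t].
  by rewrite mem_words => /perm_size.
rewrite mem_words => wP.
have wN : all (fun y => y < n.+2)%N (x :: t).
  by apply/allP=> y; rewrite (perm_mem wP) mem_iota => /andP[_].
have /andP[xN tN] : (x < n.+2)%N && all (fun y => y < n.+2)%N t := wN.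
have size_t : size t = n by have [] := perm_size wP; rewrite size_iota.
rewrite big_insertions.
have front := @word_lmi_insert n.+2 [::] (x :: t) wN.
have front' := @word_rmi_insert n.+2 [::] (x :: t) wN.
have back := @word_lmi_insert n.+2 (x :: t) [::].
have back' := @word_rmi_insert n.+2 (x :: t) [::].
rewrite cats0 in back back'; move: (back wN) (back' wN) => {}back {}back'.
rewrite -cats1 -cat_cons.
move: front front' back back'; rewrite ![[::] ++ _]/= => -> -> -> ->.
(* At either end the new maximum is no peak, its outer neighbour being infinite, and the letter
   beside it is no peak before or after. *)
have -> : word_peaks [:: n.+2, x & t] = word_peaks (x :: t).
  rewrite /=; case: (t) => [|y t'] //=.
  by rewrite [(n.+2 < x)%N]ltnNge (ltnW xN).
have -> : word_peaks ((x :: t) ++ [:: n.+2]) = word_peaks (x :: t).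
  elim: (t) (x) xN tN => [|y t' IHt] // z zN /= /andP[yN t'N].
  move: (IHt y yN t'N) => /= ->.
  by case: (t') => //=; rewrite [(n.+2 < y)%N]ltnNge (ltnW yN) andbF.
have inner : \sum_(w <- inner_insertions n.+2 (x :: t))
     F (word_peaks w) * (a ^+ (word_lmi w - 1) * b ^+ (word_rmi w - 1)) =
   (\sum_(w <- inner_insertions n.+2 (x :: t)) F (word_peaks w)) *
   (a ^+ (word_lmi (x :: t) - 1) * b ^+ (word_rmi (x :: t) - 1)).
  rewrite mulr_suml big_seq [RHS]big_seq; apply: eq_bigr => w.
  case/mem_inner_insertions=> u [v [u0 v0 xtE ->]].
  have uvN : all (fun y => y < n.+2)%N (u ++ v) by rewrite -xtE.
  rewrite (word_lmi_insert uvN) (word_rmi_insert uvN).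
  by rewrite (negPf u0) (negPf v0) -xtE.
rewrite inner.
have -> : \sum_(w <- inner_insertions n.+2 (x :: t)) F (word_peaks w) =
    (word_peaks (x :: t)).*2%:R * F (word_peaks (x :: t))
    + (n%:R - (word_peaks (x :: t)).*2%:R) * F (word_peaks (x :: t)).+1.
  (* A one-letter word has no inner gap; here n = 0 and both coefficients vanish. *)
  case: t wN size_t {wP xN tN inner} => [|y t] wN size_t.
    by rewrite -size_t big_nil /= subrr !mul0r addr0.
  by rewrite big_peaks_inner_insertions // -size_t.
case: (word_lmi _) (@word_lmi_gt0 (x :: t) isT) => // l _.
case: (word_rmi _) (@word_rmi_gt0 (x :: t) isT) => // r _.
rewrite !add1n !add0n !subn1 /= !exprS.
ring.
Qed.

(** The recurrence changes [F], hence the induction for all [F] at once. It starts from the single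
    one-letter word, whose weight is 1. *)
Lemma word_sum_eq (R : comPzRingType) (a b c d : R) (n : nat) (F : nat -> R) :
  a + b = c + d -> word_sum a b n.+1 F = word_sum c d n.+1 F.
Proof.
move=> abcd; elim: n F => [|n IHn] F.
  by rewrite /word_sum !big_seq1.
by rewrite !word_sumS IHn abcd.
Qed.

(** * Translation between permutations and words *)

Definition word_of (n : nat) (s : 'S_n) : seq nat :=
  [seq (s j).+1 | j <- enum 'I_n].

Lemma size_word_of (n : nat) (s : 'S_n) : size (word_of s) = n.
Proof. by rewrite size_map size_enum_ord. Qed.

Lemma nth_word_of (n : nat) (s : 'S_n) (x0 : nat) (i : 'I_n) :
  nth x0 (word_of s) i = (s i).+1.
Proof. by rewrite (nth_map i) ?size_enum_ord // nth_ord_enum. Qed.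

Lemma word_of_inj (n : nat) : injective (@word_of n).
Proof.
move=> s t st; apply/permP=> i; apply/val_inj/succn_inj.
by rewrite -!(nth_word_of _ 0%N) st.
Qed.

Lemma word_of_perm (n : nat) (s : 'S_n) : perm_eq (word_of s) (iota 1 n).
Proof.
have -> : iota 1 n = [seq (val j).+1 | j <- enum 'I_n].
  by rewrite (map_comp succn val) val_enum_ord; exact: (iotaDl 1 0).
rewrite /word_of (map_comp (fun j : 'I_n => (val j).+1) s); apply: perm_map.
apply: uniq_perm; rewrite ?(map_inj_uniq perm_inj) ?enum_uniq //.
move=> i; rewrite mem_enum; apply/mapP; exists (s^-1%g i).
  by rewrite mem_enum.
by rewrite permKV.
Qed.

Lemma perm_words (n : nat) :
  perm_eq [seq word_of s | s <- enum 'S_n] (words n).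
Proof.
have uniq_l : uniq [seq word_of s | s <- enum 'S_n].
  by rewrite map_inj_uniq ?enum_uniq //; apply: word_of_inj.
have sub_l : {subset [seq word_of s | s <- enum 'S_n] <= words n}.
  by move=> w /mapP[s _ ->]; rewrite mem_words word_of_perm.
have size_r : (size (words n) <= size [seq word_of s | s <- enum 'S_n])%N.
  by rewrite size_words size_map -cardE card_Sn.
apply: uniq_perm => //; first exact: leq_size_uniq size_r.
by have [] := uniq_min_size uniq_l sub_l size_r.
Qed.

(** The default [N] of [nth] plays the infinite right neighbour, so the last letter never counts;
    [x] is the left neighbour of the first letter. *)
Lemma word_peaksE (N x : nat) (w : seq nat) :
  all (fun y => y < N)%N w ->
  word_peaks (x :: w) =
  (\sum_(i < size w) ((nth N (x :: w) i < nth N w i)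
                      && (nth N w i.+1 < nth N w i)))%N.
Proof.
elim: w x => [|y w IHw] x; first by rewrite big_ord0.
case/andP=> yN wN; rewrite big_ord_recl /= -(IHw y wN) /=.
by case: w {IHw wN} => [|z w] //=; rewrite [(N < y)%N]ltnNge (ltnW yN) andbF.
Qed.

Lemma word_rmiE (w : seq nat) :
  word_rmi w =
  (\sum_(i < size w) all (fun y => nth 0 w i < y) (drop i.+1 w))%N.
Proof.
elim: w => [|x w IHw]; first by rewrite big_ord0.
by rewrite big_ord_recl /= drop0 IHw.
Qed.

Lemma word_lmiE (w : seq nat) :
  word_lmi w =
  (\sum_(i < size w) all (fun y => nth 0 w i < y) (take i w))%N.
Proof.
(* Induction from the right end, because [word_lmi] reverses the word. *)
elim/last_ind: w => [|w x IHw]; first by rewrite big_ord0.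
rewrite size_rcons big_ord_recr /= /word_lmi rev_rcons /= all_rev addnC.
rewrite -/(word_lmi w) IHw nth_rcons ltnn eqxx -cats1 take_size_cat //.
congr (_ + _)%N; apply: eq_bigr => i _.
by rewrite nth_cat ltn_ord takel_cat // ltnW.
Qed.

Lemma peaks_word_of (n : nat) (s : 'S_n) : peaks s = word_peaks (word_of s).
Proof.
have wN : all (fun y => y < n.+1)%N (word_of s).
  by apply/allP=> y /mapP[j _ ->]; rewrite ltnS.
(* [word_peaks] tests interior letters only. Prepending the boundary value n+1 makes the first
   letter interior, but not a peak. *)
have -> : word_peaks (word_of s) = word_peaks (n.+1 :: word_of s).
  case: (word_of s) wN => [|x [|y w]] //= /andP[xN _].
  by rewrite [(n.+1 < x)%N]ltnNge (ltnW xN).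
rewrite (word_peaksE _ wN) size_word_of /peaks -sum1dep_card big_mkcond /=.
by apply: eq_bigr => i _; case: ifP.
Qed.

Lemma rmi_word_of (n : nat) (s : 'S_n) : rmi s = word_rmi (word_of s).
Proof.
rewrite word_rmiE size_word_of /rmi -sum1dep_card big_mkcond /=.
apply: eq_bigr => i _; rewrite nth_word_of.
suff -> : [forall j : 'I_n, (i < j)%N ==> (s i < s j)%N]
    = all (fun y => (s i).+1 < y)%N (drop i.+1 (word_of s)) by case: ifP.
apply/forallP/(all_nthP 0%N) => [smin k | smin j].
  rewrite size_drop size_word_of ltn_subRL nth_drop => lt_k.
  rewrite (nth_word_of s 0%N (Ordinal lt_k)) ltnS.
  by apply: (implyP (smin _)); rewrite /= addSn ltnS leq_addr.
apply/implyP=> ij; have := smin (j - i.+1)%N.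
rewrite size_drop size_word_of nth_drop subnKC // nth_word_of ltnS.
by apply; rewrite ltn_sub2r // (leq_ltn_trans ij).
Qed.

Lemma lmi_word_of (n : nat) (s : 'S_n) : lmi s = word_lmi (word_of s).
Proof.
rewrite word_lmiE size_word_of /lmi -sum1dep_card big_mkcond /=.
apply: eq_bigr => i _; rewrite nth_word_of.
suff -> : [forall j : 'I_n, (j < i)%N ==> (s i < s j)%N]
    = all (fun y => (s i).+1 < y)%N (take i (word_of s)) by case: ifP.
have size_i : size (take i (word_of s)) = i.
  by rewrite size_takel // size_word_of ltnW.
apply/forallP/(all_nthP 0%N) => [smin k | smin j].
  rewrite size_i => ki; have kn := ltn_trans ki (ltn_ord i).
  rewrite nth_take // (nth_word_of s 0%N (Ordinal kn)) ltnS.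
  exact: (implyP (smin (Ordinal kn))).
apply/implyP=> ji; have := smin j.
by rewrite size_i nth_take // nth_word_of ltnS; apply.
Qed.

(** * Specialization to a fixed number of peaks *)

Lemma sum_perms_with_peaks (R : pzSemiRingType) (a b : R) (n k : nat) :
  \sum_(s in perms_with_peaks n k) a ^+ (lmi s - 1) * b ^+ (rmi s - 1)
  = word_sum a b n (fun p => (p == k)%:R).
Proof.
rewrite /word_sum -(perm_big _ (perm_words n)) big_map big_enum big_mkcond /=.
apply: eq_bigr => s _; rewrite inE peaks_word_of lmi_word_of rmi_word_of.
by case: eqP => _; rewrite ?mul1r ?mul0r.
Qed.

Theorem theorem1p6 (n k : nat) (hn : (1 <= n)%N) :
  \sum_(s in perms_with_peaks n k)
      (2 * alpha) ^+ (lmi s - 1) * (2 * beta) ^+ (rmi s - 1)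
  = \sum_(s in perms_with_peaks n k)
      (alpha + beta) ^+ (lmi s + rmi s - 2).
Proof.
case: n hn => // n _.
have word0 (s : 'S_n.+1) : word_of s != [::].
  by rewrite -size_eq0 size_word_of.
(* The intermediate sum has both parameters equal to [alpha + beta]; its two powers merge because
   [lmi s] and [rmi s] are positive. *)
transitivity (\sum_(s in perms_with_peaks n.+1 k)
    (alpha + beta) ^+ (lmi s - 1) * (alpha + beta) ^+ (rmi s - 1)).
  rewrite !sum_perms_with_peaks; apply: word_sum_eq.
  by ring.
apply: eq_bigr => s _; rewrite -exprD.
have := word_lmi_gt0 (word0 s); have := word_rmi_gt0 (word0 s).
rewrite -lmi_word_of -rmi_word_of.
by case: (lmi s) => // l; case: (rmi s) => // r _ _; rewrite addSn addnS !subSS !subn0.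
Qed.
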